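(* Let $\epsilon>0$ and $m,n\in\mathbb{N}$, and let $\delta=\epsilon/(2m)$. Then every anonymous game in $L(n,m,\delta)$ admits a pure $\epsilon$-equilibrium.
   Context: An $n$-player game $G$ in normal form is given by finite strategy sets $A_1,\dots,A_n$ and payoff functions $f_i:A\to\mathbb{R}$, where $A=\prod_{i=1}^n A_i$; write $a=(a_i,a_{-i})$ with $a_{-i}\in A_{-i}=\prod_{j\ne i}A_j$. On $A_{-i}$ use the metric $\rho(a'_{-i},a''_{-i})=\#\{j\ne i: a'_j\ne a''_j\}$. The Lipschitz constant of $G$ is $\delta(G)=\max|f_i(a_i,a'_{-i})-f_i(a_i,a''_{-i})|$ over all players $i$, all $a_i\in A_i$ and all $a'_{-i},a''_{-i}$ with $\rho(a'_{-i},a''_{-i})=1$. $L(n,m,\delta)$ is the set of games with $n$ players, at most $m$ strategies for every player, and Lipschitz constant at most $\delta$. A game is anonymous if all players have the same strategy set and the payoff of each player $i$ does not change when two other players $j,k$ (both different from $i$) exchange the strategies they play. A pure $\epsilon$-equilibrium is a profile $a\in A$ with $f_i(d,a_{-i})\le f_i(a)+\epsilon$ for all players $i$ and all $d\in A_i$. *)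

(* Defs.v *)
From mathcomp Require Import all_boot all_order all_algebra all_fingroup.
From mathcomp Require Import reals.

Set Implicit Arguments.
Unset Strict Implicit.
Unset Printing Implicit Defensive.

Import Order.TTheory GRing.Theory Num.Theory.
Local Open Scope ring_scope.

(* As usual for normal-form games, strategy sets are nonempty. *)
Record game (R : realType) (n : nat) := Game {
  strat : 'I_n -> finType;
  strat_nonempty : forall i, (0 < #|strat i|)%N;
  payoff : 'I_n -> {dffun forall i, strat i} -> R
}.

Section Games.
Variables (R : realType) (n : nat).
Implicit Type G : game R n.

Definition profile G : finType := {dffun forall i, strat G i}.

(* A point a_{-i} of A_{-i} is represented by any full profile a extending it;
   [play a d] is (d, a_{-i}), which does not depend on the coordinate a i. *)
Definition play G (a : profile G) (i : 'I_n) (d : strat G i) : profile G :=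
  [ffun j => dfwith a d j].

Definition rho G (i : 'I_n) (a' a'' : profile G) : nat :=
  #|[set j | (j != i) && (a' j != a'' j)]|.

(* All terms are nonnegative, so the default value 0 of the maximum matters
   only when there is no pair at distance 1 (e.g. n <= 1): the constant is
   then 0. *)
Definition lipschitz_const G : R :=
  \big[Num.max/0]_(i < n) \big[Num.max/0]_(d : strat G i)
    \big[Num.max/0]_(p : profile G * profile G | rho i p.1 p.2 == 1%N)
      `|payoff i (play p.1 d) - payoff i (play p.2 d)|.

Definition L (m : nat) (delta : R) G : Prop :=
  (forall i, (#|strat G i| <= m)%N) /\ lipschitz_const G <= delta.

Definition swap (T : finType) (j k : 'I_n) (a : {dffun 'I_n -> T}) :
    {dffun 'I_n -> T} :=
  [ffun l => a (tperm j k l)].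

Definition anonymous G : Prop :=
  exists (T : finType) (T0 : 'I_n -> (0 < #|T|)%N)
         (f : 'I_n -> {dffun 'I_n -> T} -> R),
    G = @Game R n (fun=> T) T0 f /\
    forall i j k a, j != i -> k != i -> f i (swap j k a) = f i a.

Definition pure_equilibrium G (eps : R) (a : profile G) : Prop :=
  forall (i : 'I_n) (d : strat G i),
    payoff i (play a d) <= payoff i a + eps.

End Games.

(* Main.v *)
Require Import Defs.
From mathcomp Require Import all_boot all_order all_algebra all_fingroup.
From mathcomp Require Import reals.
From mathcomp Require Import zify ring lra.

(* In an anonymous game the payoff of a player depends only on his own strategy
   and on the vector counting how often each strategy is played, and as such it
   is delta-Lipschitz.  It therefore extends (McShane) to all real vectors y
   with nonnegative entries of sum n.  Give each player a mixed strategy that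
   depends continuously on y and is supported on his almost-best replies to y;
   by Brouwer's theorem some y is almost equal to the sum of these mixed
   strategies.  Hall's theorem rounds them to a pure profile, inside their
   supports, whose count of each strategy s exceeds y s by little more than 1
   at most.  As some count does not exceed y, the counts lie within about
   |T| - 1 of y, T being the strategy set, and comparing payoffs at y bounds
   all regrets by 2 |T| delta.

   The approximate form of Brouwer's theorem comes from Scarf's parity argument
   with linear orders on grid points, which replaces triangulations. *)

Set Implicit Arguments.
Unset Strict Implicit.
Unset Printing Implicit Defensive.

Import Order.TTheory GRing.Theory Num.Theory.

(** * Scarf's lemma *)

(* The elements [e s] are Scarf's slack vectors: [e s] is the least element of
   the order [r s] and lies above all non-slack elements in the other orders. *)
Section Scarf.
Variables (T V : finType) (e : T -> V) (r : T -> V -> nat) (c : V -> T).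
Hypothesis r_inj : forall s, injective (r s).
Hypothesis e_min : forall s v, r s (e s) <= r s v.
Hypothesis e_max :
  forall s t v, t != s -> v \notin codom e -> r s v < r s (e t).
Hypothesis ce : cancel e c.
Variable v0 : V.
Hypothesis v0N : v0 \notin codom e.

(** Scarf's dominating sets, the substitute for the simplices of a triangulation: no [v] lies, in
    every order at once, strictly above some element of [U]. *)
Definition dominant (U : {set V}) :=
  [forall v, exists s, [forall (u | u \in U), r s v <= r s u]].

Lemma dominantP (U : {set V}) :
  reflect (forall v, exists s, forall u, u \in U -> r s v <= r s u)
          (dominant U).
Proof.
apply: (iffP forallP) => H v; have := H v.
  by case/existsP=> s /forall_inP ?; exists s.
by case=> s ?; apply/existsP; exists s; apply/forall_inP.
Qed.

Lemma dominantS (D U : {set V}) : D \subset U -> dominant U -> dominant D.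
Proof.
move=> /subsetP DU /dominantP domU; apply/dominantP => v.
by have [s sP] := domU v; exists s => u /DU /sP.
Qed.

(** Rooms stand for full-dimensional simplices, doors of type [i] for facets that carry every colour
    but [i] exactly once. *)
Definition room (U : {set V}) := (#|U| == #|T|) && dominant U.

Definition door i (D : {set V}) :=
  [&& dominant D, #|D|.+1 == #|T| & c @: D == [set~ i]].

Lemma door_inj i D : door i D -> {in D &, injective c}.
Proof.
case/and3P=> _ /eqP cD /eqP ciD; apply/imset_injP.
by rewrite ciD cardsC1 -cD.
Qed.

Lemma card_succ_subset (D U : {set V}) :
  D \subset U -> #|D|.+1 = #|U| -> exists2 x, x \notin D & U = x |: D.
Proof.
move=> DU cDU.
have : #|U :\: D| == 1 by rewrite cardsD (setIidPr DU) -cDU subSnn.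
case/cards1P=> x Ux; exists x.
  by have := set11 x; rewrite -Ux inE => /andP[].
by rewrite -(setID U D) (setIidPr DU) Ux setUC.
Qed.

(* Either no door of type [i] lies in [U], or exactly two do: they are obtained
   by removing one of the two elements of [U] that share a colour. *)
Lemma room_door_even i U :
  room U -> c @: U != setT -> ~~ odd #|[set D | door i D && (D \subset U)]|.
Proof.
case/andP=> /eqP cU domU ncol.
set S := [set D | _].
case: (set_0Vmem S) => [->|[D]]; first by rewrite cards0.
rewrite inE => /andP[doorD DU].
have cinjD := door_inj doorD.
case/and3P: (doorD) => domD /eqP cD /eqP ciD.
have [x xD Ux] := card_succ_subset DU (etrans cD (esym cU)).
have cx : c x \in c @: D.
  rewrite ciD !inE; apply: contraNneq ncol => cxi.
  by rewrite Ux imsetU1 ciD cxi setUCr.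
case/imsetP: cx => y yD cxy.
have xU : x \in U by rewrite Ux setU11.
have yU : y \in U by apply: (subsetP DU).
have xy : x != y by apply: contraNneq xD => ->.
have cyi : c @: (U :\ y) = [set~ i].
  apply/eqP; rewrite eqEsubset; apply/andP; split.
    apply/subsetP => _ /imsetP[z zU ->]; rewrite -ciD.
    move: zU; rewrite Ux !inE => /andP[_ /orP[/eqP->|zD]].
      by rewrite cxy; apply: imset_f.
    exact: imset_f.
  rewrite -ciD; apply/subsetP => _ /imsetP[z zD ->].
  have [->|zy] := eqVneq z y.
    by rewrite -cxy; apply: imset_f; rewrite !inE xy.
  by apply: imset_f; rewrite !inE zy; apply: (subsetP DU).
suff -> : S = [set D; U :\ y].
  rewrite cards2; suff -> : D != U :\ y by [].
  by apply: contraNneq xD => ->; rewrite !inE xy.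
apply/setP => D'; rewrite !inE; apply/idP/idP; last first.
  case/orP=> /eqP->; first by rewrite doorD.
  rewrite subD1set andbT; apply/and3P; split; last exact/eqP.
    exact: dominantS (subD1set U y) domU.
  by rewrite -cU (cardsD1 y U) yU.
case/andP=> doorD' D'U.
have cinjD' := door_inj doorD'.
case/and3P: (doorD') => _ /eqP cD' _.
have [z zD' Uz] := card_succ_subset D'U (etrans cD' (esym cU)).
have -> : D' = U :\ z by rewrite Uz setU1K.
have -> : D = U :\ x by rewrite Ux setU1K.
have [->|zx] := eqVneq z x; first by rewrite eqxx.
have [->|zy] := eqVneq z y; first by rewrite eqxx orbT.
case/eqP: xy; apply: cinjD' cxy.
  by have := xU; rewrite Uz !inE eq_sym (negPf zx).
by have := yU; rewrite Uz !inE eq_sym (negPf zy).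
Qed.

Lemma e_codom s : e s \in codom e.
Proof. exact: codom_f. Qed.

(** The boundary facet of the parity argument: the only door of type [i] that lies in one room
    instead of two. *)
Definition outer_door i : {set V} := e @: [set~ i].

Lemma outer_doorP i : door i (outer_door i).
Proof.
apply/and3P; split.
- apply/dominantP => v; have [/codomP[t ->]|vN] := boolP (v \in codom e).
    by exists t.
  by exists i => _ /imsetP[t tP ->]; apply/ltnW/e_max => //; move: tP; rewrite !inE.
- rewrite card_imset; last exact: can_inj ce.
  by rewrite cardsC1 prednK //; apply/card_gt0P; exists i.
- by apply/eqP; rewrite -imset_comp (eq_imset _ ce) imset_id.
Qed.

(** A room around this door adds [e i] or a non-slack element. Dominance at [v0] excludes [e i], and
    forces the added element to be [r i]-maximal among the non-slack ones. *)
Lemma rooms_outer_door i :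
  #|[set U | room U && (outer_door i \subset U)]| = 1.
Proof.
have /and3P[_ /eqP cD _] := outer_doorP i.
case: (@arg_maxnP _ v0 (fun v => v \notin codom e) (r i) v0N) => z zN zmax0.
have zmax v : v \notin codom e -> r i v <= r i z := @zmax0 v.
apply/eqP/cards1P; exists (z |: outer_door i).
have eD s : s != i -> e s \in outer_door i.
  by move=> si; apply: imset_f; rewrite !inE.
have zD : z \notin outer_door i.
  by apply: contra zN => /imsetP[t _ ->]; apply: e_codom.
have nocodom U : dominant U -> forall v, v \notin codom e ->
    exists2 s, e s \notin U & forall u, u \in U -> r s v <= r s u.
  move=> /dominantP dU v vN; have [s sP] := dU v; exists s => //.
  apply: contra vN => /sP le_ve.
  suff -> : v = e s by apply: e_codom.
  by apply: (@r_inj s); apply/eqP; rewrite eqn_leq le_ve e_min.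
apply/setP => U; rewrite !inE; apply/idP/idP; last first.
  move/eqP->; rewrite subsetUr andbT; apply/andP; split.
    by rewrite cardsU1 zD add1n cD.
  apply/dominantP => v; have [/codomP[t ->]|vN] := boolP (v \in codom e).
    by exists t.
  exists i => u; rewrite !inE => /orP[/eqP->|]; first exact: zmax.
  by case/imsetP=> t; rewrite !inE => ti ->; apply/ltnW/e_max.
case/andP=> /andP[/eqP cU dU] DU.
have [x xD Ux] := card_succ_subset DU (etrans cD (esym cU)).
have eU s : e s \notin U -> s = i.
  by apply: contraNeq => /eD /(subsetP DU).
have xN : x \notin codom e.
  apply/negP => /codomP[t xt].
  have xi : x = e i.
    by rewrite xt; congr e; apply: contraNeq xD; rewrite xt => /eD.
  have [s sU _] := nocodom U dU v0 v0N.
  by case/negP: (sU); rewrite (eU _ sU) -xi Ux setU11.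
rewrite Ux; apply/eqP; congr (_ |: _).
apply: (@r_inj i); apply/eqP; rewrite eqn_leq zmax //=.
have [s sU sP] := nocodom U dU z zN.
by rewrite -{1 2}(eU _ sU); apply: sP; rewrite Ux setU11.
Qed.

(* The minima [mu s] of [D] in the orders [r s] coincide for exactly one pair of
   indices; each index [j] of the pair gives one room, by adding the [r j]-largest
   element that exceeds [mu s] in [r s] for every other [s]. *)
Lemma rooms_inner_door i D : door i D -> D != outer_door i ->
  #|[set U | room U && (D \subset U)]| = 2.
Proof.
move=> /and3P[domD /eqP cD /eqP ciD] DnO.
have [y0 y0D y0N] : exists2 y, y \in D & y \notin codom e.
  apply/exists_inP; apply: contraNT DnO; rewrite negb_exists_in => /forall_inP De.
  apply/eqP; rewrite /outer_door -ciD -imset_comp.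
  rewrite -[LHS]imset_id; apply: eq_in_imset => v /De; rewrite negbK.
  by case/codomP=> t ->; rewrite /= ce.
pose mu s := [arg min_(v < y0 | v \in D) r s v].
have muP s : mu s \in D /\ forall v, v \in D -> r s (mu s) <= r s v.
  by rewrite /mu; case: arg_minnP.
have muD s := (muP s).1; have mu_le s := (muP s).2.
have muE s v : v \in D -> (forall u, u \in D -> r s v <= r s u) -> v = mu s.
  move=> vD vmin; apply: (@r_inj s); apply/eqP.
  by rewrite eqn_leq vmin ?mu_le.
have mu_surj v : v \in D -> exists s, v = mu s.
  move=> vD; have /dominantP/(_ v)[s sP] := domD.
  by exists s; apply: muE.
have mu_onto : mu @: setT = D.
  apply/setP => v; apply/imsetP/idP => [[s _ ->] //|/mu_surj[s ->]].
  by exists s.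
(* Pigeonhole: [D] has one element less than [T]. *)
have [s1 [s2 [s12 mu12]]] : exists s1 s2, s1 != s2 /\ mu s1 = mu s2.
  have : ~~ injectiveb mu.
    apply/negP => /injectiveP/(card_imset setT).
    by rewrite mu_onto cardsT -cD => /n_Sn.
  by case/injectivePn=> s1 [s2 ? ?]; exists s1, s2.
have inj_of s : (forall v, v \in D -> exists2 t, t != s & v = mu t) ->
    {in [set~ s] &, injective mu}.
  move=> surj; apply/imset_injP; rewrite cardsC1 -cD /=.
  suff -> : mu @: [set~ s] = D by [].
  apply/setP => v; apply/imsetP/idP => [[t _ ->] //|/surj[t ts ->]].
  by exists t; rewrite ?inE.
have surj_j j : j \in [:: s1; s2] ->
    forall v, v \in D -> exists2 t, t != j & v = mu t.
  move=> jP v /mu_surj[s ->]; have [->|] := eqVneq s j; last by exists s.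
  move: jP; rewrite !inE => /orP[]/eqP->; last by exists s1.
  by exists s2; rewrite // eq_sym.
pose M j := [pred v | [forall (s | s != j), r s (mu s) < r s v]].
have eM j : e j \in M j.
  apply/forall_inP => s sj; apply: leq_ltn_trans (mu_le s _ y0D) _.
  by apply: e_max; rewrite // eq_sym.
pose z j := [arg max_(v > e j | v \in M j) r j v].
have zP j : z j \in M j /\ forall v, v \in M j -> r j v <= r j (z j).
  by rewrite /z; case: arg_maxnP => //; apply: eM.
have MD j v : j \in [:: s1; s2] -> v \in M j -> v \notin D.
  move=> jP /forall_inP vM; apply/negP => /(surj_j j jP)[t tj vt].
  by have := vM t tj; rewrite -vt ltnn.
have Mlt j v : j \in [:: s1; s2] -> v \in M j -> r j v < r j (mu j).
  move=> jP vM; have /dominantP/(_ v)[s sP] := domD.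
  have sj : s = j.
    apply/eqP; apply: contraTT (sP _ (muD s)) => sj; rewrite -ltnNge.
    by move/forall_inP: vM => /(_ s sj).
  subst s; rewrite ltn_neqAle sP // andbT.
  apply: contra (MD _ _ jP vM) => /eqP/r_inj ->; exact: muD.
have zroom j : j \in [:: s1; s2] -> room (z j |: D).
  move=> jP; have [zM zmax] := zP j; apply/andP; split.
    by rewrite cardsU1 (MD _ _ jP zM) add1n cD.
  apply/dominantP => v.
  have [vM|] := boolP (v \in M j).
    exists j => u; rewrite !inE => /orP[/eqP->|uD]; first exact: zmax.
    by apply: leq_trans (mu_le j _ uD); apply/ltnW/Mlt.
  rewrite inE negb_forall_in => /exists_inP[s sj]; rewrite -leqNgt => vle.
  exists s => u; rewrite !inE => /orP[/eqP->|uD].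
    by apply: leq_trans vle (ltnW _); move/forall_inP: zM => /(_ s sj).
  exact: leq_trans vle (mu_le s _ uD).
have s1P : s1 \in [:: s1; s2] by rewrite inE eqxx.
have s2P : s2 \in [:: s1; s2] by rewrite !inE eqxx orbT.
suff -> : [set U | room U && (D \subset U)] = [set z s1 |: D; z s2 |: D].
  rewrite cards2; suff -> : z s1 |: D != z s2 |: D by [].
  have z12 : z s1 != z s2.
    apply/eqP => z12; have := Mlt s2 (z s2) s2P (zP s2).1.
    have /forall_inP/(_ s2) := (zP s1).1; rewrite eq_sym s12 z12 => /(_ isT).
    by move=> lt1 /(ltn_trans lt1); rewrite ltnn.
  apply: contraNneq (MD s1 (z s1) s1P (zP s1).1) => E.
  by have := setU11 (z s1) D; rewrite E !inE (negPf z12).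
apply/setP => U; rewrite !inE; apply/idP/idP; last first.
  by case/orP=> /eqP->; rewrite zroom ?subsetUr.
case/andP=> /andP[/eqP cU domU] DU.
have [x xD Ux] := card_succ_subset DU (etrans cD (esym cU)).
have xU : x \in U by rewrite Ux setU11.
have /dominantP/(_ x)[j jx] := domU.
(* As [x] is [r j]-minimal in [U], each element of [D] is the minimum of an order other than [j]. So
   [mu] is injective off [j], and [j] belongs to the colliding pair. *)
have mint v : v \in D -> exists t, [/\ t != j, v = mu t & r t v < r t x].
  move=> vD; have /dominantP/(_ v)[t tP] := domU.
  have vU := subsetP DU v vD.
  have ltx : r t v < r t x.
    rewrite ltn_neqAle tP // andbT; apply: contra xD => /eqP/r_inj <- //.
  exists t; split=> //; last first.
    by apply: muE => // u /(subsetP DU) /tP.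
  by apply: contraTneq ltx => ->; rewrite -leqNgt jx.
have injj : {in [set~ j] &, injective mu}.
  by apply: inj_of => v /mint[t [tj vt _]]; exists t.
have jP : j \in [:: s1; s2].
  rewrite !inE; apply: contraNT s12; rewrite negb_or => /andP[j1 j2].
  by apply/eqP; apply: injj; rewrite // !inE eq_sym.
have xM : x \in M j.
  apply/forall_inP => s sj; have [t [tj mst lt]] := mint _ (muD s).
  by rewrite [s](@injj s t) ?inE //; rewrite -mst.
have xz : x = z j.
  apply: (@r_inj j); apply/eqP; rewrite eqn_leq (zP j).2 //=.
  have /dominantP/(_ (z j))[t tP] := domU.
  suff tj : t = j by rewrite -{1 3}tj tP.
  apply/eqP; apply: contraTT (tP _ (subsetP DU _ (muD t))) => tj.
  by rewrite -ltnNge; have /forall_inP/(_ t tj) := (zP j).1.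
by rewrite Ux xz; move: jP; rewrite !inE => /orP[]/eqP->; rewrite eqxx ?orbT.
Qed.

(** Count the incidences between doors of type [i] and rooms. Inner doors lie in two rooms and the
    outer one in a single room, so the total is odd; without a fully coloured room every room would
    contribute an even number. *)
Lemma scarf (i : T) : exists2 U, dominant U & c @: U = setT.
Proof.
have [/exists_inP[U /andP[_ dU] /eqP]|] :=
  boolP [exists (U | room U), c @: U == setT]; first by exists U.
rewrite negb_exists_in => /forall_inP nocol; exfalso.
have : \sum_(D | door i D) #|[set U | room U && (D \subset U)]| =
       \sum_(U | room U) #|[set D | door i D && (D \subset U)]|.
  under eq_bigr do rewrite -sum1dep_card big_mkcondr /=.
  rewrite exchange_big; apply: eq_bigr => U _.
  by rewrite -big_mkcondr sum1dep_card.
move/(congr1 odd); rewrite (bigD1 (outer_door i)) ?outer_doorP //=.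
rewrite rooms_outer_door oddD.
rewrite [in X in _ (+) X](eq_bigr (fun=> 2)); last first.
  by move=> D /andP[]; apply: rooms_inner_door.
rewrite sum_nat_const oddM andbF /= => /esym.
suff /negPf-> : ~~ odd (\sum_(U | room U) #|[set D | door i D && (D \subset U)]|).
  by [].
elim/big_ind: _ => // [a b|U rU]; first by rewrite oddD => /negPf-> /negPf->.
by apply: room_door_even => //; apply: nocol.
Qed.

End Scarf.

(** * Brouwer's theorem, approximately *)

Section Grid.
Variables (T : finType) (K : nat).

Definition grid : finType := {x : {ffun T -> 'I_K.+1} | \sum_s x s == K}.

Lemma grid_sum (x : grid) : \sum_s sval x s = K.
Proof. exact/eqP/(svalP x). Qed.

Lemma gridP (z : T -> nat) :
  \sum_s z s = K -> exists x : grid, forall s, sval x s = z s :> nat.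
Proof.
move=> zK; have zE s : (inord (z s) : 'I_K.+1) = z s :> nat.
  by rewrite inordK // ltnS -zK (bigD1 s) //= leq_addr.
have xP : \sum_s [ffun s => inord (z s) : 'I_K.+1] s == K.
  by apply/eqP; rewrite -[RHS]zK; apply: eq_bigr => s _; rewrite ffunE.
by exists (exist (fun x : {ffun T -> 'I_K.+1} => \sum_s x s == K) _ xP) => s /=; rewrite ffunE.
Qed.

Lemma grid_exceed (t0 : T) (P : T -> nat) :
  \sum_s P s + #|T| <= K -> exists x : grid, forall s, P s < sval x s.
Proof.
move=> le_K.
pose z s := (P s).+1 + (s == t0) * (K - (\sum_s P s + #|T|)).
have [|x xz] := @gridP z; last first.
  by exists x => s; rewrite xz /z addSn ltnS leq_addr.
rewrite big_split /= -big_distrl /=.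
have -> : \sum_(s : T) (P s).+1 = \sum_s P s + #|T|.
  by under eq_bigr do rewrite -addn1; rewrite big_split /= sum1_card.
have -> : \sum_(s : T) (s == t0) = 1.
  by rewrite (bigD1 t0) //= eqxx big1 // => s /negPf->.
by rewrite mul1n subnKC.
Qed.

(* Orders the grid points by their coordinate [s], ties being broken by
   [enum_rank]. *)
Definition grid_rank (s : T) (v : grid + T) : nat :=
  match v with
  | inl x => (sval x s * #|grid| + enum_rank x).+1
  | inr t => if t == s then 0 else (K.+1 * #|grid|).+1 + enum_rank t
  end.

Lemma grid_rank_lt s x t : t != s -> grid_rank s (inl x) < grid_rank s (inr t).
Proof.
move=> /negPf /= ->; rewrite addSn ltnS.
apply: leq_trans (leq_addr _ _).
apply: leq_trans (_ : (sval x s).+1 * #|grid| <= _).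
  by rewrite mulSn addnC ltn_add2r ltn_ord.
by rewrite leq_mul2r ltn_ord orbT.
Qed.

Lemma grid_rank_le s x y :
  grid_rank s (inl x) <= grid_rank s (inl y) -> sval x s <= sval y s.
Proof.
rewrite /= ltnS; apply: contraTT; rewrite -!ltnNge => yx.
apply: leq_trans (_ : (sval y s).+1 * #|grid| <= _).
  by rewrite mulSn addnC ltn_add2r ltn_ord.
by apply: leq_trans (leq_addr _ _); rewrite leq_mul2r yx orbT.
Qed.

Lemma grid_rank_inj s : injective (grid_rank s).
Proof.
move=> [x|t] [y|u] E.
- have := @grid_rank_le s x y; have := @grid_rank_le s y x.
  rewrite E leqnn => /(_ isT) le1 /(_ isT) le2.
  have Exy : sval x s = sval y s :> nat by apply/eqP; rewrite eqn_leq le1 le2.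
  move: E; rewrite /= Exy => -[] /addnI /val_inj /enum_rank_inj -> //.
- have [us|us] := eqVneq u s; first by move: E; rewrite /= us eqxx.
  by have := grid_rank_lt x us; rewrite E ltnn.
- have [ts|ts] := eqVneq t s; first by move: E; rewrite /= ts eqxx.
  by have := grid_rank_lt y ts; rewrite E ltnn.
- move: E => /=; have [->|_] := eqVneq t s; have [->|_] := eqVneq u s => //.
  by move/addnI/val_inj/enum_rank_inj->.
Qed.

(** A Sperner-type statement: every colour whose coordinate is not small occurs near [x]. The grid
    points of Scarf's fully coloured set share lower bounds [P] whose sum exceeds [K - #|T|], so
    each coordinate varies by less than [#|T|] among them. *)
Lemma grid_coloring (t0 : T) (c : grid -> T) :
  exists x : grid, forall s, sval x s < #|T| \/
    exists2 x' : grid, c x' = s &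
      forall t, sval x t <= sval x' t + #|T| /\ sval x' t <= sval x t + #|T|.
Proof.
have [x0 _] : exists x0 : grid, forall s, sval x0 s = (s == t0) * K :> nat.
  apply: gridP; rewrite -big_distrl (bigD1 t0) //= eqxx big1 ?mul1n //.
  by move=> s /negPf->.
pose c' (v : grid + T) := match v with inl x => c x | inr t => t end.
have [||||U /dominantP domU colU] :=
    @scarf T (grid + T)%type inr grid_rank c' grid_rank_inj _ _ _ (inl x0) _ t0.
- by move=> s v /=; rewrite eqxx.
- move=> s t [x|u] ts; first by move=> _; apply: grid_rank_lt.
  by rewrite codom_f.
- by [].
- by apply/negP => /codomP[].
have domX (z : grid) : exists2 s, inr s \notin U &
    forall y : grid, inl y \in U -> sval z s <= sval y s.
  have [s sP] := domU (inl z); exists s => [|y /sP]; last exact: grid_rank_le.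
  by apply/negP => /sP; rewrite /= eqxx.
have colP s : inr s \in U \/ exists2 x : grid, c x = s & inl x \in U.
  have : s \in c' @: U by rewrite colU.
  by case/imsetP=> -[x|t] vU /= ->; [right; exists x|left].
have [s0 s0U _] := domX x0.
have [x xU] : exists x : grid, inl x \in U.
  by case: (colP s0) => [s0U'|[x _ ?]]; [rewrite s0U' in s0U|exists x].
(* The common lower bound on coordinate [s]; a slack element [inr s] in [U] stands for the bound
   0. *)
pose P s : nat := if inr s \in U then 0
  else sval [arg min_(y < x | inl y \in U) (sval y s : nat)] s.
have P_le (y : grid) s : inl y \in U -> P s <= sval y s.
  by move=> yU; rewrite /P; case: ifP => // _; case: arg_minnP => // z _; apply.
(* Otherwise some grid point would exceed [P] in every coordinate, against dominance. *)
have P_sum : K < \sum_s P s + #|T|.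
  rewrite ltnNge; apply/negP => /(grid_exceed t0)[z zP].
  have [s sU sP] := domX z; have := zP s.
  rewrite /P (negPf sU); case: arg_minnP => // y yU _.
  by rewrite ltnNge sP.
have P_ge (y : grid) s : inl y \in U -> sval y s < P s + #|T|.
  move=> yU; rewrite -(ltn_add2r (\sum_(t | t != s) P t)).
  apply: leq_ltn_trans (_ : K < _).
    have := grid_sum y; rewrite (bigD1 s) //= => E; rewrite -[leqRHS]E leq_add2l.
    by apply: leq_sum => t _; apply: P_le.
  by apply: leq_trans P_sum _; rewrite (bigD1 s) //= addnAC.
exists x => s; have [sU|[x' cx' x'U]] := colP s.
  by left; have := P_ge x s xU; rewrite /P sU.
right; exists x' => // t; split.
  by apply/ltnW/(leq_trans (P_ge x t xU)); rewrite leq_add2r P_le.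
by apply/ltnW/(leq_trans (P_ge x' t x'U)); rewrite leq_add2r P_le.
Qed.

End Grid.

Section Brouwer.
Local Open Scope ring_scope.
Variables (R : realType) (T : finType).

(** Lipschitz for the sup norm; [h] is any bound on the coordinatewise distances, so no maximum has
    to be formed. *)
Definition lip (f : (T -> R) -> R) : Prop :=
  exists2 k : R, 0 <= k & forall (h : R) (y z : T -> R),
    (forall s, `|y s - z s| <= h) -> `|f y - f z| <= k * h.

(** Colour a grid point by a coordinate that [G] does not decrease. At the point given by
    [grid_coloring] no coordinate falls by more than [eta / #|T|]; as [G] preserves the sum, none
    rises by more than [eta]. *)
Lemma approx_brouwer (t0 : T) (N eta : R) (G : T -> (T -> R) -> R) :
  0 < N -> 0 < eta ->
  (forall y, (forall s, 0 <= y s) -> \sum_s y s = N -> \sum_s G s y = N) ->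
  (forall s y, 0 <= G s y) ->
  (forall s, lip (G s)) ->
  exists y : T -> R, [/\ forall s, 0 <= y s, \sum_s y s = N &
    forall s, G s y <= y s + eta].
Proof.
move=> N0 eta0 G_sum G_ge0 G_lip.
have [k k0 kP] : exists2 k : R, 0 <= k & forall s h y z,
    (forall s, `|y s - z s| <= h) -> `|G s y - G s z| <= k * h.
  have : forall s, exists k : R, 0 <= k /\ forall h y z,
      (forall s, `|y s - z s| <= h) -> `|G s y - G s z| <= k * h.
    by move=> s; have [k ? ?] := G_lip s; exists k.
  case/fin_all_exists=> k kP; exists (\sum_s k s).
    by apply: sumr_ge0 => s _; have [] := kP s.
  move=> s h y z yz; have [k0 /(_ h y z yz) le] := kP s.
  apply: le_trans le _; apply: ler_wpM2r.
    by apply: le_trans (yz s); apply: normr_ge0.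
  by rewrite (bigD1 s) //= lerDl; apply: sumr_ge0 => t _; have [] := kP t.
set q : R := #|T|%:R.
have q0 : 0 < q by rewrite ltr0n; apply/card_gt0P; exists t0.
pose sigma := eta / q.
have sigma0 : 0 < sigma by apply: divr_gt0.
(* Fineness of the grid: over a distance [q * h] a coordinate changes by at most [q * h] and [G s]
   by at most [k * (q * h)]; together these must not exceed [sigma]. *)
pose C := (k + 1) * q * N / sigma.
have C0 : 0 < C by rewrite divr_gt0 // !mulr_gt0 // ltr_wpDl.
pose K := Num.bound C.
have CK : C < K%:R by apply: archi_boundP; apply: ltW.
have K0 : 0 < K%:R :> R by apply: lt_trans CK.
pose h := N / K%:R.
have h0 : 0 < h by apply: divr_gt0.
have hsmall : (k + 1) * (q * h) <= sigma.
  rewrite /h !mulrA ler_pdivrMr // [leRHS]mulrC -ler_pdivrMr //.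
  exact: ltW.
pose pt (x : grid T K) s : R := (sval x s)%:R * h.
have pt_ge0 x s : 0 <= pt x s by rewrite mulr_ge0 // ltW.
have pt_sum x : \sum_s pt x s = N.
  by rewrite -mulr_suml -natr_sum grid_sum /h mulrC divfK // gt_eqF.
have sum_ge x : exists s, pt x s <= G s (pt x).
  apply/existsP; apply: contraT; rewrite negb_exists => /forallP lt.
  have := G_sum _ (pt_ge0 x) (pt_sum x); rewrite -[RHS](pt_sum x) => E.
  suff : \sum_s G s (pt x) < \sum_s pt x s by rewrite E ltxx.
  apply: ltr_sum => [|s _]; last by rewrite ltNge lt.
  by apply/hasP; exists t0; rewrite ?mem_index_enum.
have [c cP] := fin_all_exists sum_ge.
have [x xP] := grid_coloring t0 c.
(* The colour of a point is a coordinate that [G] does not decrease there. *)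
have low s : pt x s - sigma <= G s (pt x).
  have [xs|[x' cx' xx']] := xP s.
    apply: le_trans (G_ge0 _ _); rewrite subr_le0.
    apply: le_trans hsmall; rewrite -[pt x s]mul1r.
    apply: ler_pM => //; first by rewrite lerDr.
    by rewrite ler_wpM2r ?ler_nat ?(ltnW xs) ?(ltW h0).
  have close t : `|pt x t - pt x' t| <= q * h.
    have [le1 le2] := xx' t.
    rewrite /pt -mulrBl normrM (gtr0_norm h0) ler_wpM2r ?(ltW h0) //.
    by rewrite ler_distl /q lerBlDr -!natrD !ler_nat le1 le2.
  have := kP s _ _ _ close; have := close s; have := cP x'; rewrite cx'.
  move: hsmall; rewrite !ler_norml mulrDl mul1r; lra.
exists (pt x); split=> // s.
have E : \sum_t (G t (pt x) - pt x t) = 0 by rewrite sumrB G_sum ?pt_sum ?subrr.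
move: E; rewrite (bigD1 s) //= => /eqP; rewrite addr_eq0 => /eqP E.
rewrite addrC -lerBlDr E -sumrN.
have -> : eta = \sum_(t : T) sigma by rewrite sumr_const -mulr_natr divfK // gt_eqF.
rewrite [leRHS](bigD1 s) //=; apply: ler_wpDl; first exact: ltW.
by apply: ler_sum => t _; rewrite opprB lerBlDr addrC -lerBlDr low.
Qed.

End Brouwer.

(** * Rounding *)

Section Hall.
Variables (I T : finType) (A : I -> {set T}).

(* Tight sets are closed under union, so some admissible choice for the next
   element lies in no tight set. *)
Lemma hall_capacity (t0 : T) (P : {set I}) (k : T -> nat) :
  (forall S : {set T}, #|[set i in P | A i \subset S]| <= \sum_(s in S) k s) ->
  exists2 a : I -> T, {in P, forall i, a i \in A i} &
    forall s, #|[set i in P | a i == s]| <= k s.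
Proof.
have [N] := ubnP #|P|; elim: N P k => // N IH P k PN hall.
have [->|[i iP]] := set_0Vmem P.
  exists (fun=> t0) => [i|s]; first by rewrite inE.
  by rewrite (_ : [set _ in _ | _] = set0) ?cards0 //; apply/setP => i; rewrite !inE.
pose Nb (S : {set T}) := #|[set j in P :\ i | A j \subset S]|.
have hall' S : Nb S <= \sum_(s in S) k s.
  apply: leq_trans (hall S); apply: subset_leq_card.
  by apply/subsetP => j; rewrite !inE => /andP[/andP[_ ->] ->].
have NbI S1 S2 : Nb S1 + Nb S2 <= Nb (S1 :|: S2) + Nb (S1 :&: S2).
  rewrite /Nb -cardsUI; apply: leq_add; apply: subset_leq_card.
    apply/subsetP => j; rewrite !inE -andb_orr => /andP[-> /orP[]] jS /=.
      exact: subset_trans jS (subsetUl _ _).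
    exact: subset_trans jS (subsetUr _ _).
  apply/subsetP => j; rewrite !inE => /andP[/andP[-> j1] /andP[_ j2]] /=.
  by rewrite subsetI j1.
pose tight (S : {set T}) := \sum_(s in S) k s <= Nb S.
have tightU S1 S2 : tight S1 -> tight S2 -> tight (S1 :|: S2).
  move=> t1 t2; rewrite /tight -(leq_add2r (\sum_(s in S1 :&: S2) k s)).
  have -> : \sum_(s in S1 :|: S2) k s + \sum_(s in S1 :&: S2) k s =
            \sum_(s in S1) k s + \sum_(s in S2) k s.
    have mk (S : {set T}) : \sum_(s in S) k s = \sum_s (s \in S) * k s.
      by rewrite big_mkcond; apply: eq_bigr => s _; case: ifP; rewrite ?mul1n ?mul0n.
    rewrite !mk -!big_split; apply: eq_bigr => s _ /=.
    by rewrite !inE; case: (s \in S1); case: (s \in S2); rewrite ?addn0.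
  apply: leq_trans (leq_add t1 t2) _; apply: leq_trans (NbI _ _) _.
  by rewrite leq_add2l.
have [s sA sfree] : exists2 s, s \in A i &
      forall S : {set T}, s \in S -> ~~ tight S.
  (* The union of all tight sets is tight; it cannot contain [A i], because Hall's condition for it
     counts [i] as well. *)
  pose U := \bigcup_(S | tight S) S.
  have tU : tight U.
    by rewrite /U; elim/big_ind: _ => //; rewrite /tight big_set0.
  have /subsetPn[s sA sU] : ~~ (A i \subset U).
    apply/negP => AU; have := leq_trans (hall U) tU.
    rewrite /Nb (cardsD1 i) !inE iP AU /= add1n ltnNge => /negP[].
    apply: subset_leq_card; apply/subsetP => j; rewrite !inE.
    by case/andP=> /andP[-> ->] ->.
  by exists s => // S sS; apply: contra sU => tS; apply/bigcupP; exists S.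
have ks : 0 < k s.
  have := sfree [set s]; rewrite set11 => /(_ isT).
  by rewrite /tight big_set1 -ltnNge; apply: leq_ltn_trans.
pose k' t := k t - (t == s).
have kE t : k t = (t == s) + k' t.
  by rewrite /k' subnKC //; case: eqP => // ->.
have [||a aA ak] := IH (P :\ i) k'.
- by move: PN; rewrite (cardsD1 i) iP.
- move=> S; have [sS|sS] := boolP (s \in S).
    have := sfree S sS; rewrite /tight -ltnNge.
    rewrite (eq_bigr _ (fun t _ => kE t)) big_split /=.
    rewrite (bigD1 s) //= eqxx big1 ?addn0 ?add1n; first by rewrite ltnS.
    by move=> t /andP[_ /negPf->].
  apply: leq_trans (hall' S) _; apply: leq_sum => t tS.
  rewrite /k' (_ : t == s = false) ?subn0 //.
  by apply: contraNF sS => /eqP <-.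
exists (fun j => if j == i then s else a j) => [j jP|t].
  by case: eqP => [->|/eqP ji] //; apply: aA; rewrite !inE ji.
rewrite (cardsD1 i) !inE iP eqxx /= kE eq_sym leq_add2l.
apply: leq_trans (ak t); apply: subset_leq_card; apply/subsetP => j.
by rewrite !inE => /and3P[/negPf ji ->]; rewrite ji.
Qed.

End Hall.

Section Rounding.
Local Open Scope ring_scope.

Lemma ex_nat_ceil (R : realType) (y : R) :
  0 <= y -> exists2 k : nat, y <= k%:R & k%:R < y + 1.
Proof.
move=> y0; have ex : exists k : nat, y <= k%:R.
  by exists (Num.bound y); apply/ltW/archi_boundP.
case: (ex_minnP ex) => k yk kmin; exists k => //.
case: k yk kmin => [|k] _ kmin; first by rewrite ltr_wpDl.
by rewrite -natr1 ltrD2r ltNge; apply/negP => /kmin; rewrite ltnn.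
Qed.

(** The capacities are the column sums rounded up. Hall's condition holds since every [i] whose
    support lies in [S] puts its whole mass 1 into [S]. *)
Lemma round_assignment (R : realType) (I T : finType) (t0 : T)
    (p : I -> T -> R) :
  (forall i s, 0 <= p i s) -> (forall i, \sum_s p i s = 1) ->
  exists2 a : I -> T, forall i, 0 < p i (a i) &
    forall s, (\sum_i (a i == s))%:R < \sum_i p i s + 1.
Proof.
move=> p0 p1; have y0 s : 0 <= \sum_i p i s by apply: sumr_ge0.
have : forall s, exists k : nat, \sum_i p i s <= k%:R /\ k%:R < \sum_i p i s + 1.
  by move=> s; have [k ? ?] := ex_nat_ceil (y0 s); exists k.
case/fin_all_exists=> k kP.
have [S|a aA ak] :=
    @hall_capacity I T (fun i => [set s | 0 < p i s]) t0 setT k.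
  rewrite -(ler_nat R) natr_sum.
  apply: le_trans (_ : \sum_(s in S) \sum_i p i s <= _); last first.
    by apply: ler_sum => s _; have [] := kP s.
  rewrite exchange_big /= -sum1_card natr_sum [leLHS]big_mkcond /=.
  apply: ler_sum => i _; case: ifP => [|_]; last exact: sumr_ge0.
  rewrite !inE => /subsetP sub; rewrite -(p1 i) [leRHS]big_mkcond /=.
  apply: ler_sum => s _; case: ifPn => // sS.
  by rewrite leNgt; apply: contra sS => ps; apply: sub; rewrite inE.
exists a => [i|s]; first by have := aA i (in_setT i); rewrite inE.
have [_ klt] := kP s; apply: le_lt_trans klt; rewrite ler_nat.
apply: leq_trans (ak s); rewrite -sum1dep_card big_mkcond /= [leqRHS]big_mkcond.
by apply: leq_sum => i _; rewrite inE; case: eqP.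
Qed.

End Rounding.

(** * Anonymous games *)

Section Anonymous.
Variables (R : realType) (n : nat) (T : finType).
Implicit Types a b : {dffun 'I_n -> T}.

Definition cnt a (s : T) : nat := \sum_j (a j == s).

Definition mismatch a b := [set j | a j != b j].

Lemma cnt_sum a : \sum_s cnt a s = n.
Proof.
rewrite exchange_big /= -[RHS]card_ord -sum1_card; apply: eq_bigr => j _.
by rewrite (bigD1 (a j)) //= eqxx big1 // => s; rewrite eq_sym => /negPf->.
Qed.

Lemma cnt_le a b s : (forall j, a j = s -> b j = s) -> cnt a s <= cnt b s.
Proof.
by move=> ab; apply: leq_sum => j _; case: eqP => // /ab ->; rewrite eqxx.
Qed.

Lemma cnt_lt a b s j :
  (forall j, a j = s -> b j = s) -> a j != s -> b j = s -> cnt a s < cnt b s.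
Proof.
move=> ab ajs bjs; rewrite /cnt (bigD1 j) //= [ltnRHS](bigD1 j) //=.
rewrite bjs (negPf ajs) eqxx add0n add1n ltnS.
by apply: leq_sum => k _; case: eqP => // /ab ->; rewrite eqxx.
Qed.

Lemma cnt_swap a j k s : cnt (swap j k a) s = cnt a s.
Proof.
rewrite /cnt [RHS](reindex_inj (@perm_inj _ (tperm j k))) /=.
by apply: eq_bigr => l _; rewrite ffunE.
Qed.

Variables (i : 'I_n) (delta : R).
Variable f : {dffun 'I_n -> T} -> R.
Hypothesis f_swap : forall j k a, j != i -> k != i -> f (swap j k a) = f a.
Hypothesis f_lip : forall a b, a i = b i -> #|mismatch a b| = 1 ->
  (`|f a - f b| <= delta)%R.

(* Induction on the number of mismatches: some mismatch can be corrected either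
   by a swap, which is free, or by a unilateral change that costs [delta] and
   lowers the distance of the counts by one. *)
Lemma payoff_lip a b : a i = b i ->
  (`|f a - f b| <= delta * (\sum_s (cnt a s - cnt b s))%:R)%R.
Proof.
have [N] := ubnP #|mismatch a b|; elim: N a => // N IH a aN abi.
have [ab|/set0Pn[j0 j0P]] := eqVneq (mismatch a b) set0.
  have -> : a = b.
    apply/ffunP => j; apply/eqP.
    by have := in_set0 j; rewrite -ab inE => /negbFE.
  by rewrite subrr normr0 big1 ?mulr0 // => s _; rewrite subnn.
(* A mismatch at a strategy that [a] over-uses; when there is no such strategy, the counts agree
   because their sums do, and any mismatch serves. *)
have [j abj jP] : exists2 j, a j != b j &
    cnt b (a j) < cnt a (a j) \/ forall s, cnt a s = cnt b s.
  have [/existsP[s sP]|] := boolP [exists s, cnt b s < cnt a s].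
    have : ~~ [forall j, (a j == s) ==> (b j == s)].
      apply/negP => /forallP ab; move: sP; rewrite ltnNge cnt_le // => j ajs.
      by have := ab j; rewrite ajs eqxx => /eqP.
    case/forallPn=> j; rewrite negb_imply => /andP[/eqP ajs bjs].
    by exists j; rewrite ajs; [rewrite eq_sym|left].
  rewrite negb_exists => /forallP le; exists j0; first by rewrite inE in j0P.
  have {}le s : cnt a s <= cnt b s by rewrite leqNgt.
  right => s; apply/eqP; rewrite eqn_leq le /=.
  rewrite -(leq_add2r (\sum_(t | t != s) cnt a t)).
  apply: leq_trans (_ : n <= _); last first.
    by have := cnt_sum a; rewrite (bigD1 s) //= => ->.
  have := cnt_sum b; rewrite (bigD1 s) //= => E; rewrite -[leqRHS]E leq_add2l.
  exact: leq_sum.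
have ji : j != i by apply: contraNneq abj => ->; rewrite abi.
have [/existsP[k /andP[/eqP akt bkt]]|] :=
    boolP [exists k, (a k == b j) && (b k != b j)].
  have ki : k != i by apply: contraNneq bkt => ki; rewrite -akt ki abi.
  rewrite -(f_swap a ji ki).
  rewrite -(eq_bigr _ (fun s _ => congr1 (subn^~ (cnt b s)) (cnt_swap a j k s))).
  apply: IH; last by rewrite ffunE tpermD // eq_sym.
  rewrite -ltnS (leq_trans _ aN) // ltnS; apply: proper_card.
  apply/properP; split.
    apply/subsetP => l; rewrite !inE ffunE.
    by case: tpermP => // -> _ //; rewrite akt eq_sym.
  by exists j; rewrite !inE // ffunE tpermL akt eqxx.
rewrite negb_exists => /forallP nok.
(* Now every player choosing [b j] in [a] also does so in [b], while [j] does so only in [b]. *)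
have lt_t : cnt a (b j) < cnt b (b j).
  apply: (@cnt_lt _ _ _ j) => // l alj.
  by have := nok l; rewrite alj eqxx /= negbK => /eqP.
case: jP => [lt_s|E]; last by rewrite E ltnn in lt_t.
pose a' : {dffun 'I_n -> T} := [ffun l => if l == j then b j else a l].
have cntE c u : cnt c u = (c j == u) + \sum_(l | l != j) (c l == u).
  by rewrite /cnt (bigD1 j).
have cnta' u : cnt a' u + (a j == u) = cnt a u + (b j == u).
  rewrite !cntE [a' j]ffunE eqxx addnC addnA addnAC; congr (_ + _ + _).
  by apply: eq_bigr => l /negPf lj; rewrite ffunE lj.
have mm : #|mismatch a a'| = 1.
  apply/eqP/cards1P; exists j; apply/setP => l; rewrite !inE ffunE.
  by case: (l =P j) => [->|_]; rewrite ?abj ?eqxx.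
have a'i : a' i = a i by rewrite ffunE eq_sym (negPf ji).
(* Moving [j] lowers the count of the over-used [a j] by one; the under-used [b j] still contributes
   0 to the truncated differences. *)
have -> : \sum_s (cnt a s - cnt b s) = (\sum_s (cnt a' s - cnt b s)).+1.
  rewrite (bigD1 (a j)) //= [in RHS](bigD1 (a j)) //=.
  rewrite -addSn; congr addn.
    have := cnta' (a j); rewrite eqxx [b j == _]eq_sym (negPf abj); lia.
  apply: eq_bigr => u uj; have := cnta' u; rewrite [a j == u]eq_sym (negPf uj).
  by case: eqP => [<-|_]; lia.
rewrite -natr1 mulrDr mulr1 [leRHS]addrC -[f a](subrK (f a')) -addrA.
apply: le_trans (ler_normD _ _) _; apply: lerD; first exact: f_lip.
apply: IH; last by rewrite a'i.
rewrite -ltnS (leq_trans _ aN) // ltnS; apply: proper_card.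
apply/properP; split.
  by apply/subsetP => l; rewrite !inE ffunE; case: (l =P j) => // ->; rewrite eqxx.
by exists j; rewrite !inE // ffunE !eqxx.
Qed.

End Anonymous.

Local Open Scope ring_scope.

(** * Closure properties of Lipschitz functions *)

Section Lipschitz.
Variables (R : realType) (T : finType).
Implicit Types f g : (T -> R) -> R.

Lemma lip_ext f g : f =1 g -> lip f -> lip g.
Proof. by move=> fg [k k0 kP]; exists k => // h y z /kP; rewrite !fg. Qed.

Lemma lip_cst (x : R) : lip (fun _ : T -> R => x).
Proof. by exists 0 => // h y z _; rewrite subrr normr0 mul0r. Qed.

Lemma lip_coord s : lip (fun y : T -> R => y s).
Proof. by exists 1 => // h y z; rewrite mul1r. Qed.

Lemma lipD f g : lip f -> lip g -> lip (fun y => f y + g y).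
Proof.
move=> [k k0 kP] [l l0 lP]; exists (k + l); first exact: addr_ge0.
move=> h y z yz; rewrite mulrDl opprD addrACA.
by apply: le_trans (ler_normD _ _) _; apply: lerD; [apply: kP|apply: lP].
Qed.

Lemma lipZ (x : R) f : lip f -> lip (fun y => x * f y).
Proof.
move=> [k k0 kP]; exists (`|x| * k); first by rewrite mulr_ge0.
by move=> h y z yz; rewrite -mulrBr normrM -mulrA ler_wpM2l // kP.
Qed.

Lemma lipB f g : lip f -> lip g -> lip (fun y => f y - g y).
Proof.
move=> lf lg; apply: lip_ext (lipD lf (lipZ (-1) lg)) => y.
by rewrite mulN1r.
Qed.

Lemma lip_max f g : lip f -> lip g -> lip (fun y => Num.max (f y) (g y)).
Proof.
move=> [k k0 kP] [l l0 lP]; exists (k + l); first exact: addr_ge0.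
move=> h y z yz; have := kP h y z yz; have := lP h y z yz.
rewrite mulrDl !ler_norml.
by case: (lerP (f y) (g y)); case: (lerP (f z) (g z)); lra.
Qed.

Lemma lip_sum (I : Type) (r : seq I) (P : pred I) (F : I -> (T -> R) -> R) :
  (forall i, lip (F i)) -> lip (fun y => \sum_(i <- r | P i) F i y).
Proof.
move=> lF; elim: r => [|i r IH].
  by apply: lip_ext (lip_cst 0) => y; rewrite big_nil.
have [Pi|Pi] := boolP (P i).
  by apply: lip_ext (lipD (lF i) IH) => y; rewrite big_cons Pi.
by apply: lip_ext IH => y; rewrite big_cons (negPf Pi).
Qed.

Lemma lip_bigmax (I : Type) (r : seq I) (P : pred I) f
    (F : I -> (T -> R) -> R) : lip f ->
  (forall i, lip (F i)) -> lip (fun y => \big[Num.max/f y]_(i <- r | P i) F i y).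
Proof.
move=> lf lF; elim: r => [|i r IH].
  by apply: lip_ext lf => y; rewrite big_nil.
have [Pi|Pi] := boolP (P i).
  by apply: lip_ext (lip_max (lF i) IH) => y; rewrite big_cons Pi.
by apply: lip_ext IH => y; rewrite big_cons (negPf Pi).
Qed.

(** As the ratio is at most 1 and the denominator at least [c], two quotients differ by at most the
    change of the numerator plus that of the denominator, divided by [c]. *)
Lemma lip_div (c : R) f g : 0 < c -> (forall y, 0 <= f y <= g y) ->
  (forall y, c <= g y) -> lip f -> lip g -> lip (fun y => f y / g y).
Proof.
move=> c0 fg cg [k k0 kP] [l l0 lP]; exists ((k + l) / c).
  by rewrite divr_ge0 ?addr_ge0 // ltW.
move=> h y z yz.
have gy := lt_le_trans c0 (cg y); have gz := lt_le_trans c0 (cg z).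
have E : f y / g y - f z / g z =
    ((f y - f z) + f z / g z * (g z - g y)) / g y.
  by field; rewrite !gt_eqF.
rewrite E normrM normfV (gtr0_norm gy) ler_pdivrMr //.
apply: le_trans (_ : (k + l) * h <= _); last first.
  have kh : 0 <= (k + l) * h.
    rewrite mulrDl addr_ge0 //.
      exact: le_trans (normr_ge0 _) (kP _ _ _ yz).
    exact: le_trans (normr_ge0 _) (lP _ _ _ yz).
  rewrite [(k + l) / c * h]mulrAC [leRHS]mulrAC ler_pdivlMr //.
  by rewrite ler_wpM2l.
apply: le_trans (ler_normD _ _) _; rewrite mulrDl; apply: lerD; first exact: kP.
rewrite normrM; apply: le_trans (_ : 1 * `|g z - g y| <= _); last first.
  by rewrite mul1r distrC lP.
rewrite ler_wpM2r //; have /andP[fz0 fgz] := fg z.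
by rewrite ger0_norm ?divr_ge0 ?(ltW gz) // ler_pdivrMr // mul1r.
Qed.

End Lipschitz.

(** * Extended payoffs and existence of an equilibrium *)

Section Equilibrium.
Variables (R : realType) (n : nat) (T : finType) (t0 : T) (delta : R).
Hypothesis n0 : (0 < n)%N.
Hypothesis delta0 : 0 < delta.
Implicit Types a b : {dffun 'I_n -> T}.
Variable f : 'I_n -> {dffun 'I_n -> T} -> R.
Hypothesis f_swap :
  forall i j k a, j != i -> k != i -> f i (swap j k a) = f i a.
Hypothesis f_lip : forall i a b, a i = b i -> #|mismatch a b| = 1%N ->
  `|f i a - f i b| <= delta.

(* Half the l^1 distance from [cnt a] to [y], when [y] sums to [n]. *)
Definition excess a (y : T -> R) : R := \sum_s Num.max 0 ((cnt a s)%:R - y s).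

(** McShane's extension of the payoff [i] gets from [d]. The default value is itself one of the
    terms, that of the constant profile [d]. *)
Definition ext_payoff (i : 'I_n) (d : T) (y : T -> R) : R :=
  \big[Num.max/f i [ffun=> d] - delta * excess [ffun=> d] y]_(
      a : {dffun 'I_n -> T} | a i == d) (f i a - delta * excess a y).

Lemma lip_ext_payoff i d : lip (ext_payoff i d).
Proof.
have lH a : lip (fun y => f i a - delta * excess a y).
  apply: lipB; first exact: lip_cst.
  apply/lipZ/lip_sum => s; apply: lip_max; first exact: lip_cst.
  by apply: lipB; [apply: lip_cst|apply: lip_coord].
by apply: lip_bigmax => //; apply: lH.
Qed.

Lemma ext_payoff_ge i a y : f i a - delta * excess a y <= ext_payoff i (a i) y.
Proof.
exact: (le_bigmax_cond _ (fun a => f i a - delta * excess a y)).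
Qed.

Lemma excess_sym a (y : T -> R) : \sum_s y s = n%:R ->
  \sum_s Num.max 0 (y s - (cnt a s)%:R) = excess a y.
Proof.
move=> yn; apply/eqP; rewrite -subr_eq0 -sumrB.
rewrite (eq_bigr (fun s => y s - (cnt a s)%:R)) => [|s _].
  by rewrite sumrB yn -natr_sum cnt_sum subrr.
by rewrite -(opprB (y s)); case: (lerP 0 (y s - (cnt a s)%:R));
  case: (lerP 0 (- (y s - (cnt a s)%:R))); lra.
Qed.

(** Triangle inequality through [y]: the payoff of a competing profile [b] exceeds [f i a] by at
    most [delta * (excess b y + excess a y)]. *)
Lemma ext_payoff_le i a y : \sum_s y s = n%:R ->
  ext_payoff i (a i) y <= f i a + delta * excess a y.
Proof.
move=> yn.
have H b : b i = a i -> f i b - delta * excess b y <= f i a + delta * excess a y.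
  move=> bai; rewrite lerBlDr -addrA -lerBlDl -mulrDr.
  apply: le_trans (ler_norm _) _.
  apply: le_trans (payoff_lip (f_swap (i := i)) (f_lip (i := i)) bai) _.
  rewrite ler_pM2l // -(excess_sym a yn) -big_split /= natr_sum.
  apply: ler_sum => s _.
  have -> : (cnt b s - cnt a s)%:R = Num.max 0 ((cnt b s)%:R - (cnt a s)%:R) :> R.
    have [le|/ltnW le] := leqP (cnt b s) (cnt a s).
      by rewrite (eqP le) max_l // subr_le0 ler_nat.
    by rewrite natrB // max_r // subr_ge0 ler_nat.
  case: (lerP 0 ((cnt b s)%:R - (cnt a s)%:R));
    case: (lerP 0 ((cnt b s)%:R - y s)); case: (lerP 0 (y s - (cnt a s)%:R));
    by lra.
by apply: bigmax_le => [|b /eqP]; apply: H; rewrite ?ffunE.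
Qed.

(** A move of [i] raises the count of at most one strategy, by one. *)
Lemma excess_deviation a b i y : (forall j, j != i -> b j = a j) ->
  excess b y <= excess a y + 1.
Proof.
move=> ab.
have -> : 1 = \sum_s (b i == s)%:R :> R.
  by rewrite (bigD1 (b i)) //= eqxx big1 ?addr0 // => s; rewrite eq_sym => /negPf->.
rewrite -big_split; apply: ler_sum => s _ /=.
have : (cnt b s <= cnt a s + (b i == s))%N.
  rewrite /cnt (bigD1 i) //= addnC leq_add2r [leqRHS](bigD1 i) //=.
  by apply: leq_trans (leq_addl _ _); apply: leq_sum => j /ab ->.
rewrite -(ler_nat R) natrD.
have : 0 <= (b i == s)%:R :> R by [].
case: (lerP 0 ((cnt b s)%:R - y s)); case: (lerP 0 ((cnt a s)%:R - y s)); lra.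
Qed.

(** If the rounded profile has excess [E], a deviation has excess at most [E + 1], and comparing
    payoffs through [F] at [y] bounds the regret by [(2 * E + 1) * delta + eta]. *)
Lemma anonymous_equilibrium : exists a, forall i b,
  (forall j, j != i -> b j = a j) -> f i b <= f i a + 2 * #|T|%:R * delta.
Proof.
pose q : R := #|T|%:R.
have q0 : 0 < q by rewrite ltr0n; apply/card_gt0P; exists t0.
pose F := ext_payoff.
pose top i y := \big[Num.max/F i t0 y]_t F i t y.
have top_ge i t y : F i t y <= top i y by apply: le_bigmax.
have topP i y : exists t, top i y = F i t y.
  have [t _ tP] := @arg_maxP _ _ _ t0 xpredT (F i ^~ y) isT.
  exists t; apply/le_anti; rewrite top_ge andbT.
  by apply: bigmax_le => [|u _]; apply: tP.
pose eta := delta / 2.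
have eta0 : 0 < eta by apply: divr_gt0.
(* Positive exactly on the strategies less than [eta] below the best. A best strategy has weight
   [eta], which keeps the total away from 0 and makes [p] Lipschitz. *)
pose w i s y := Num.max 0 (eta + F i s y - top i y).
pose W i y := \sum_s w i s y.
have w0 i s y : 0 <= w i s y by rewrite le_max lexx.
have wW i s y : w i s y <= W i y.
  by rewrite /W (bigD1 s) //= lerDl sumr_ge0.
have Wge i y : eta <= W i y.
  have [t tP] := topP i y; apply: le_trans (wW i t y).
  by rewrite /w tP addrK le_max lexx orbT.
have W0 i y : 0 < W i y by apply: lt_le_trans (Wge i y).
pose p i s y := w i s y / W i y.
have p0 i s y : 0 <= p i s y by apply: divr_ge0 => //; apply: ltW.
have p1 i y : \sum_s p i s y = 1 by rewrite -mulr_suml -/(W i y) divff // gt_eqF ?W0.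
have lip_w i s : lip (w i s).
  apply: lip_max; first exact: lip_cst.
  apply: lipB; first by apply: lipD; [apply: lip_cst|apply: lip_ext_payoff].
  by apply: lip_bigmax => [|t]; apply: lip_ext_payoff.
have lip_p i s : lip (p i s).
  apply: (lip_div eta0) => // [y|]; first by rewrite w0 wW.
  exact: lip_sum.
(* The excess will be at most [(q - 1) * (1 + eta2) <= q - 3 / 4]; with [eta = delta / 2] the regret
   is then at most [(2 * (q - 3 / 4) + 1 + 1 / 2) * delta = 2 * q * delta]. *)
pose eta2 := (4 * q)^-1.
have [|||||y [y0 yn Gy]] :=
    @approx_brouwer R T t0 n%:R eta2 (fun s y => \sum_i p i s y).
- by rewrite ltr0n.
- by rewrite invr_gt0 mulr_gt0.
- move=> y _ _; rewrite exchange_big /=.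
  by under eq_bigr do rewrite p1; rewrite sumr_const card_ord.
- by move=> s y; apply: sumr_ge0.
- by move=> s; apply: lip_sum.
have [a pa acnt] := round_assignment t0 (fun i s => p0 i s y) (fun i => p1 i y).
pose a' : {dffun 'I_n -> T} := [ffun i => a i].
exists a' => i b ab.
have cnt_lt s : (cnt a' s)%:R - y s <= 1 + eta2.
  have -> : cnt a' s = (\sum_i (a i == s))%N.
    by apply: eq_bigr => j _; rewrite ffunE.
  by have := acnt s; have := Gy s; lra.
have exc : excess a' y <= (q - 1) * (1 + eta2).
  (* The counts and [y] have the same sum, so some strategy is not over-used; it adds nothing, which
     leaves [q - 1] terms. *)
  have [s1 s1P] : exists s, (cnt a' s)%:R <= y s.
    apply/existsP; apply: contraT; rewrite negb_exists => /forallP lt.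
    suff : \sum_s y s < \sum_s (cnt a' s)%:R.
      by rewrite yn -natr_sum cnt_sum ltxx.
    apply: ltr_sum => [|s _]; last by rewrite ltNge lt.
    by apply/hasP; exists t0; rewrite ?mem_index_enum.
  rewrite /excess (bigD1 s1) //= max_l ?subr_le0 // add0r.
  have -> : (q - 1) * (1 + eta2) = \sum_(s | s != s1) (1 + eta2).
    rewrite sumr_const -[RHS]mulr_natl; congr (_ * _).
    by rewrite cardC1 /q (cardD1 s1) /= add1n -natr1 addrK.
  apply: ler_sum => s _; rewrite ge_max cnt_lt andbT.
  by rewrite addr_ge0 // invr_ge0 mulr_ge0 // ltW.
have near : F i (b i) y <= F i (a' i) y + eta.
  have := pa i; rewrite /p pmulr_lgt0 ?invr_gt0 // /w lt_max ltxx /=.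
  by have := top_ge i (b i) y; rewrite ffunE; lra.
have := ext_payoff_ge i b y; have := ext_payoff_le i a' yn.
have exb := excess_deviation y ab.
have eta2q : (q - 1) * eta2 <= 1 / 4.
  rewrite ler_pdivrMr ?mulr_gt0 //; lra.
have : delta * excess b y <= delta * (excess a' y + 1) by rewrite ler_pM2l.
have : delta * excess a' y <= delta * (q - 1 + 1 / 4).
  by rewrite ler_pM2l //; apply: le_trans exc _; rewrite mulrDr mulr1 lerD2l.
rewrite -/F -/q; move: near; rewrite /eta.
lra.
Qed.

End Equilibrium.

(** * Passage to games and their Lipschitz constant *)

Lemma play_id (R : realType) (n : nat) (G : game R n) (a : profile G) i :
  play a (a i) = a.
Proof. by apply/ffunP => j; rewrite ffunE; case: dfwithP. Qed.

Lemma lipschitz_const_ge (R : realType) (n : nat) (G : game R n) (i : 'I_n)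
    (a b : profile G) : a i = b i -> rho i a b = 1%N ->
  `|payoff i a - payoff i b| <= lipschitz_const G.
Proof.
move=> abi /eqP rho1.
apply: le_trans (le_bigmax _ _ i).
apply: le_trans (le_bigmax _ _ (a i)).
rewrite -{1}(play_id a i) -{1}(play_id b i) -abi.
exact: (@le_bigmax_cond _ R (profile G * profile G)%type 0 (a, b)
  (fun p => rho i p.1 p.2 == 1%N)
  (fun p => `|payoff i (play p.1 (a i)) - payoff i (play p.2 (a i))|) rho1).
Qed.

Theorem theorem3 (R : realType) (eps : R) (heps : 0 < eps) (m n : nat)
    (G : game R n) (hanon : anonymous G)
    (hL : L m (eps / (2 * m%:R)) G) :
  exists a : profile G, pure_equilibrium eps a.
Proof.
case: hanon => T [T0 [f [GE f_swap]]]; subst G.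
case: hL => /= card_le lip_le.
case: n T0 f f_swap card_le lip_le => [|n] T0 f f_swap card_le lip_le.
  (* Without players the equilibrium condition is empty and the empty profile serves. *)
  have g (i : 'I_0) : T by case: i.
  by exists (finfun g) => -[].
have /card_gt0P[t0 _] := T0 ord0.
have Tm : #|T|%:R <= m%:R :> R by rewrite ler_nat (card_le ord0).
have q0 : 0 < #|T|%:R :> R by rewrite ltr0n; apply: T0 ord0.
have m0 : 0 < m%:R :> R by apply: lt_le_trans Tm.
have delta0 : 0 < eps / (2 * m%:R) by rewrite divr_gt0 ?mulr_gt0.
set G := Game T0 f in lip_le *.
have [|a aP] := @anonymous_equilibrium R n.+1 T t0 _ isT delta0 f f_swap.
  move=> i a b abi mm; apply: le_trans lip_le.
  apply: (@lipschitz_const_ge R n.+1 G i a b abi).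
  (* [rho] leaves out coordinate [i], where [a] and [b] agree, so it equals the number of
     mismatches. *)
  rewrite -mm; apply: eq_card => j; rewrite !inE.
  by case: (j =P i) => // ->; rewrite abi eqxx.
exists a => i d.
apply: le_trans (aP i (play (G := G) a d) _) _.
  by move=> j ji; rewrite ffunE dfwith_out // eq_sym.
rewrite lerD2l mulrA ler_pdivrMr ?mulr_gt0 //.
by rewrite mulrC ler_wpM2l ?(ltW heps) // ler_pM2l.
Qed.
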